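(* Let $K$ be a field with a discrete valuation $\nu$, and let $X$ be the affine Bruhat-Tits building associated to $SL(n,K)$ and $\nu$. Then $X$ has finite asymptotic dimension.
   Context: **Valuation.** A discrete valuation on $K$ is a map $\nu:K\to\mathbb{Z}\cup\{+\infty\}$ with $\nu(a)=+\infty$ iff $a=0$, $\nu(ab)=\nu(a)+\nu(b)$ and $\nu(a+b)\ge\min(\nu(a),\nu(b))$. Its ring of integers is $\mathcal{O}=\{a\in K:\nu(a)\ge0\}$, and a uniformizer is an element $\pi\in\mathcal{O}$ with $\nu(\pi)=1$ (assumed to exist). **Building.** Let $\bar{\mathcal{L}}$ be the set of homothety classes (classes modulo $K^*$) of $\mathcal{O}$-lattices in $K^n$. The building $X$ is the $(n-1)$-dimensional simplicial complex with vertex set $\bar{\mathcal{L}}$, in which $m+1$ distinct vertices $\bar L_0,\dots,\bar L_m$ form an $m$-simplex if they have representatives with $L_0\subset L_1\subset\dots\subset L_m\subset\pi^{-1}L_0$. It is regarded as a $CAT(0)$ metric space (with its usual metric). **Asymptotic dimension.** A metric space $X$ has $\operatorname{asdim}X\le d$ if for every $r>0$ there is a uniformly bounded cover of $X$ such that every ball of radius $r$ meets at most $d+1$ elements of the cover; $\operatorname{asdim}X$ is the minimal such $d$. *)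

(* Defs.v *)
From HB Require Import structures.
From mathcomp Require Import all_boot all_order all_algebra.
From mathcomp Require Import all_classical all_reals all_analysis.
From mathcomp Require Import finmap all_fingroup zify ring lra.

Set Implicit Arguments.
Unset Strict Implicit.
Unset Printing Implicit Defensive.
Import Order.TTheory GRing.Theory Num.Theory.
Local Open Scope classical_set_scope.
Local Open Scope ring_scope.

Section AsymptoticDimension.
Context {R : realType} (X : metricType R).

Definition asdim_le (d : nat) := forall r : R, 0 < r ->
  exists U : set (set X),
  [/\ \bigcup_(A in U) A = setT,
      exists D : R, forall A, U A -> forall x y, A x -> A y -> mdist x y <= D
    & forall x, ([set A | U A /\ A `&` ball x r !=set0] #<= `I_d.+1)%card].

Definition finite_asdim := exists d, asdim_le d.

End AsymptoticDimension.

Record discrete_valuation (K : fieldType) := DiscreteValuation {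
  dval :> K -> \bar int;
  (* [\bar int] also contains -oo, which is not a value of a valuation *)
  dval_neq_ninfty : forall a, dval a <> -oo%E;
  dval_pinfty : forall a, dval a = +oo%E <-> a = 0;
  dvalM : forall a b, dval (a * b) = (dval a + dval b)%E;
  dvalD : forall a b, (Order.min (dval a) (dval b) <= dval (a + b)%R)%E;
  dval_uniformizer : exists pi, dval pi = 1%:E }.

Section Vertices.
Context {K : fieldType} (nu : discrete_valuation K) (n : nat).

Definition val_ring : {pred K} := fun a => (0 <= nu a)%E.

Definition val_lattice (g : 'M[K]_n) : set 'rV[K]_n :=
  [set u *m g | u in [set u | u \is a mxOver val_ring]].

Definition is_lattice (L : set 'rV[K]_n) :=
  exists2 g, g \in unitmx & L = val_lattice g.

Definition scale_set (a : K) (L : set 'rV[K]_n) : set 'rV[K]_n :=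
  [set a *: x | x in L].

Definition homothety_class (L : set 'rV[K]_n) : set (set 'rV[K]_n) :=
  [set scale_set a L | a in [set a | a != 0]].

Record vertex := Vertex {
  vclass : set (set 'rV[K]_n);
  vclassP : exists2 L, is_lattice L & vclass = homothety_class L }.

HB.instance Definition _ := gen_eqMixin vertex.
HB.instance Definition _ := gen_choiceMixin vertex.

Definition is_simplex (S : set vertex) :=
  exists (m : nat) (v : 'I_m.+1 -> vertex) (L : 'I_m.+1 -> set 'rV[K]_n)
    (pi : K),
  [/\ injective v /\ S = range v, nu pi = 1%:E, forall j, vclass (v j) (L j),
      forall i j : 'I_m.+1, (i <= j)%N -> L i `<=` L j
    & L ord_max `<=` scale_set pi^-1 (L ord0)].

(* Choosing another basis of L changes [\det g] by a unit of the valuation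
   ring, and a homothety of ratio a adds n * nu a to its valuation, so the
   residue mod n depends only on the class ([vtypeE] below).  For a chain of
   lattices, nu (\det g_L) - nu (\det g_M) is the length of M / L. *)
Definition vtype (v : vertex) : nat :=
  xget 0%N [set i | exists g, [/\ g \in unitmx, vclass v (val_lattice g)
    & (i : int) = (fine (nu (\det g)) %% n)%Z]].

End Vertices.

(* The geometric realization is given by barycentric coordinates. *)
Section Realization.
Context (R : realType) (K : fieldType) (nu : discrete_valuation K) (n : nat).

Record building := Building {
  bary :> vertex nu n -> R;
  bary_ge0 : forall v, 0 <= bary v;
  bary_simplex : exists2 S, is_simplex S & forall v, bary v != 0 -> S v;
  bary_sum : \sum_(v \in [set: vertex nu n]) bary v = 1 }.

HB.instance Definition _ := gen_eqMixin building.
HB.instance Definition _ := gen_choiceMixin building.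

Definition in_simplex (S : set (vertex nu n)) (x : building) :=
  forall v, x v != 0 -> S v.

(* An apartment is the Coxeter complex of type A~_(n-1) in R^n / R(1,...,1);
   its closed alcove has as vertex of type i the image of
   omega_i = (1,...,1,0,...,0) with i ones.  The folding of the building onto
   this alcove sends each vertex of type i to omega_i and is affine on
   simplices. *)
Definition folding (x : building) : 'rV[R]_n :=
  \row_(i < n) \sum_(v \in [set: vertex nu n]) x v * (i < vtype v)%:R.

(* Euclidean norm on R^n / R(1,...,1), identified with the orthogonal
   complement of (1,...,1). *)
Definition apt_norm (z : 'rV[R]_n) : R :=
  Num.sqrt (\sum_i (z 0 i - (\sum_j z 0 j) / n%:R) ^+ 2).

(* Each simplex has the Euclidean metric for which the folding is isometric;
   [chain x y l] is a piecewise linear path of length l from x to y. *)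
Inductive chain : building -> building -> R -> Prop :=
| chain_nil x : chain x x 0
| chain_cons S x y z l : is_simplex S -> in_simplex S x -> in_simplex S y ->
    chain y z l -> chain x z (apt_norm (folding x - folding y) + l).

Definition building_dist (x y : building) : R := inf [set l | chain x y l].

End Realization.

(* The building is connected and [building_dist] is a metric on it. *)
Section ValuationTheory.
Context {K : fieldType} (nu : discrete_valuation K).

Let v a := fine (nu a).

Lemma dval_fin a : a != 0 -> nu a = (v a)%:E.
Proof.
move=> a0; rewrite /v; case E : (nu a) => [k||] //.
- by move/dval_pinfty: E => E; rewrite E eqxx in a0.
- by move/dval_neq_ninfty: E.
Qed.

Lemma dval0 : nu 0 = +oo%E. Proof. exact/dval_pinfty. Qed.

Lemma fdvalM a b : a != 0 -> b != 0 -> v (a * b) = v a + v b.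
Proof.
move=> a0 b0; have ab0 : a * b != 0 by rewrite mulf_neq0.
by have := dvalM nu a b; rewrite !dval_fin// => -[].
Qed.

Lemma fdval1 : v 1 = 0.
Proof.
have := @fdvalM 1 1 (oner_neq0 _) (oner_neq0 _); rewrite mulr1 => /eqP.
by rewrite -[X in X == _]addr0 (inj_eq (addrI _)) => /eqP.
Qed.

Lemma fdvalV a : a != 0 -> v a^-1 = - v a.
Proof.
move=> a0; apply/eqP; rewrite eq_sym -subr_eq0 -opprD oppr_eq0.
by rewrite -fdvalM ?invr_neq0// mulfV// fdval1.
Qed.

Lemma fdvalN1 : v (-1) = 0.
Proof.
have N0 : -1 != 0 :> K by rewrite oppr_eq0 oner_neq0.
have := fdvalM N0 N0; rewrite mulrNN mulr1 fdval1; lia.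
Qed.

Lemma val_ringE a : a != 0 -> (a \in val_ring nu) = (0 <= v a).
Proof. by move=> a0; rewrite unfold_in /val_ring dval_fin// lee_fin. Qed.

Lemma val_ring_closed : subring_closed (val_ring nu).
Proof.
have M a b : a \in val_ring nu -> b \in val_ring nu -> a * b \in val_ring nu.
  have [->|a0] := eqVneq a 0; first by rewrite mul0r.
  have [->|b0] := eqVneq b 0; first by rewrite mulr0.
  by rewrite !val_ringE ?mulf_neq0// fdvalM//; exact: addr_ge0.
split=> [|a b aO bO|]; last exact: M.
  by rewrite val_ringE ?oner_neq0// fdval1.
have : - b \in val_ring nu.
  rewrite -mulN1r; apply: M => //.
  by rewrite val_ringE ?oppr_eq0 ?oner_neq0// fdvalN1.
move: aO; rewrite !unfold_in /val_ring => aO bO'.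
by apply: le_trans (dvalD nu a (- b)); rewrite le_min aO bO'.
Qed.

HB.instance Definition _ :=
  GRing.isSubringClosed.Build K (val_ring nu) val_ring_closed.

Lemma val_ring_scale a : a != 0 -> exists k : nat, forall pi, nu pi = 1%:E ->
  a * pi ^+ k \in val_ring nu.
Proof.
move=> a0; exists `|v a|%N => pi pi1.
have pi0 : pi != 0 by apply: contra_eqN pi1 => /eqP->; rewrite dval0.
have vX k : v (pi ^+ k) = k%:Z.
  elim: k => [|k IH]; first by rewrite expr0 fdval1.
  by rewrite exprS fdvalM ?expf_neq0// IH /v pi1 /= ; lia.
rewrite val_ringE ?mulf_neq0 ?expf_neq0// fdvalM ?expf_neq0// vX; lia.
Qed.

End ValuationTheory.

Section LatticeTheory.
Context {K : fieldType} (nu : discrete_valuation K) (n : nat).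
Let v a := fine (nu a).
Local Notation O := (val_ring nu).
Local Notation lat := (@val_lattice K nu n).
Implicit Types g h u : 'M[K]_n.

Lemma val_lattice_sub g h u : h = u *m g -> u \is a mxOver O ->
  lat h `<=` lat g.
Proof.
move=> -> uO x [w /= wO <-]; exists (w *m u); last by rewrite mulmxA.
exact: mxOverM.
Qed.

Lemma sub_val_lattice g h : g \in unitmx -> lat h `<=` lat g ->
  h *m invmx g \is a mxOver O.
Proof.
move=> gU hg; apply/mxOverP => i j.
have : lat h (row i h).
  exists (delta_mx 0 i); last by rewrite -rowE.
  by apply/mxOverP => a b; rewrite mxE rpred_nat.
move=> /hg [w /= wO E].
have -> : (h *m invmx g) i j = w 0 j.
  have -> : w = row i (h *m invmx g) by rewrite row_mul -E mulmxK.
  by rewrite !mxE.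
exact: (mxOverP wO).
Qed.

Lemma det_mxOver m (u : 'M[K]_m) : u \is a mxOver O -> \det u \in O.
Proof.
move=> uO; apply: rpred_sum => s _; apply: rpredM.
  by rewrite rpredX// rpredN rpred1.
by apply: rpred_prod => i _; exact: (mxOverP uO).
Qed.

Lemma adj_mxOver u : u \is a mxOver O -> \adj u \is a mxOver O.
Proof.
move=> uO; apply/mxOverP => i j; rewrite mxE /cofactor.
apply: rpredM; first by rewrite rpredX// rpredN rpred1.
by apply: det_mxOver; apply/mxOverP => a b; rewrite !mxE; exact: (mxOverP uO).
Qed.

Lemma invmx_mxOver u : u \is a mxOver O -> u \in unitmx -> v (\det u) = 0 ->
  invmx u \is a mxOver O.
Proof.
move=> uO uU d0; rewrite /invmx uU; apply/mxOverP => i j; rewrite !mxE.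
have du : \det u != 0 by rewrite -unitfE -unitmxE.
apply: rpredM; last by have /mxOverP/(_ i j) := adj_mxOver uO; rewrite mxE.
by rewrite val_ringE ?invr_neq0// fdvalV// [fine _]d0.
Qed.

Lemma scale_setE a (L : set 'rV[K]_n) x : a != 0 ->
  scale_set a L x = L (a^-1 *: x).
Proof.
move=> a0; apply/propext; split => [[y Ly <-]|Lx].
  by rewrite scalerA mulVf// scale1r.
by exists (a^-1 *: x) => //; rewrite scalerA mulfV// scale1r.
Qed.

Lemma scale_set_val_lattice a g : scale_set a (lat g) = lat (a *: g).
Proof.
rewrite /scale_set /val_lattice; apply/seteqP; split => x.
  by move=> [_ [w wO <-] <-]; exists w => //; rewrite scalemxAr.
by move=> [w wO <-]; exists (w *m g); [exists w|rewrite -scalemxAr].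
Qed.

Lemma unitmxZl a g : a != 0 -> (a *: g \in unitmx) = (g \in unitmx).
Proof.
move=> a0; rewrite !unitmxE detZ unitrM andbC.
by case: (_ \is a _) => //=; rewrite unitfE expf_neq0.
Qed.

Lemma fdvalX a k : a != 0 -> v (a ^+ k) = v a *+ k.
Proof.
move=> a0; elim: k => [|k IH]; first by rewrite expr0 [LHS]fdval1.
by rewrite exprS mulrS [LHS]fdvalM ?expf_neq0// [fine (nu (a ^+ k))]IH.
Qed.

Lemma fdval_detM g h : g \in unitmx -> h \in unitmx ->
  v (\det (g *m h)) = v (\det g) + v (\det h).
Proof.
by rewrite !unitmxE !unitfE => g0 h0; rewrite det_mulmx [LHS]fdvalM.
Qed.

Lemma fdval_detZ a g : a != 0 -> g \in unitmx ->
  v (\det (a *: g)) = v a *+ n + v (\det g).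
Proof.
rewrite !unitmxE !unitfE => a0 g0.
by rewrite detZ [LHS]fdvalM ?expf_neq0// [fine (nu (a ^+ n))]fdvalX.
Qed.

Lemma fdval_det_le g h : g \in unitmx -> h \in unitmx -> lat h `<=` lat g ->
  v (\det g) <= v (\det h).
Proof.
move=> gU hU /(sub_val_lattice gU) uO.
have uU : h *m invmx g \in unitmx by rewrite unitmx_mul hU unitmx_inv.
have E : h = (h *m invmx g) *m g by rewrite mulmxKV.
rewrite [in leRHS]E fdval_detM// lerDr.
have := det_mxOver uO; rewrite val_ringE//.
by rewrite unitmxE unitfE in uU.
Qed.

Lemma val_lattice_eq g h : g \in unitmx -> h \in unitmx -> lat h `<=` lat g ->
  v (\det g) = v (\det h) -> lat h = lat g.
Proof.
move=> gU hU hg d; apply/seteqP; split => //.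
have uO := sub_val_lattice gU hg.
have uU : h *m invmx g \in unitmx by rewrite unitmx_mul hU unitmx_inv.
have E : h = (h *m invmx g) *m g by rewrite mulmxKV.
apply: (@val_lattice_sub _ _ (invmx (h *m invmx g))).
  by rewrite [X in _ *m X]E mulKmx.
apply: invmx_mxOver => //; move: d.
rewrite [in X in _ = X -> _]E fdval_detM//; lia.
Qed.

Lemma mk_vertex_ex g (gU : g \in unitmx) :
  exists2 L, is_lattice nu L & homothety_class (lat g) = homothety_class L.
Proof. by exists (lat g) => //; exists g. Qed.

Definition mkv g (gU : g \in unitmx) : vertex nu n :=
  Vertex (mk_vertex_ex gU).

Lemma vertex_eq (p q : vertex nu n) : vclass p = vclass q -> p = q.
Proof.
case: p q => [P hP] [Q hQ] /= E; subst Q.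
by congr Vertex; exact: Prop_irrelevance.
Qed.

Lemma vclass_lat (p : vertex nu n) L : vclass p L ->
  exists g, [/\ g \in unitmx, L = lat g & vclass p = homothety_class (lat g)].
Proof.
have [_ [g gU ->] ->] := vclassP p.
move=> [a /= a0 <-]; exists (a *: g); rewrite unitmxZl//; split => //.
  exact: scale_set_val_lattice.
apply/seteqP; split => [_ [b b0 <-]|_ [b b0 <-]] /=.
  exists (b / a); first by rewrite /= mulf_neq0// invr_neq0.
  by rewrite !scale_set_val_lattice scalerA -mulrA mulVf// mulr1.
exists (b * a); first by rewrite /= mulf_neq0.
by rewrite !scale_set_val_lattice scalerA.
Qed.

Lemma vclass_ex (p : vertex nu n) : exists g, g \in unitmx /\ vclass p (lat g).
Proof.
have [_ [g gU ->] ->] := vclassP p; exists g; split => //.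
by exists 1; rewrite /= ?oner_neq0// scale_set_val_lattice scale1r.
Qed.

Lemma vclassE (p : vertex nu n) L : vclass p L -> vclass p = homothety_class L.
Proof. by move=> /vclass_lat[g [gU -> ->]]. Qed.

Lemma vclass_scale (p : vertex nu n) a L : a != 0 -> vclass p L ->
  vclass p (scale_set a L).
Proof. by move=> a0 /vclassE ->; exists a. Qed.

Lemma vclass_inj (p q : vertex nu n) L : vclass p L -> vclass q L -> p = q.
Proof. by move=> /vclassE pL /vclassE qL; apply: vertex_eq; rewrite pL. Qed.

Lemma fdval_det_eq g h : g \in unitmx -> h \in unitmx -> lat g = lat h ->
  v (\det g) = v (\det h).
Proof.
by move=> gU hU E; apply/eqP; rewrite eq_le !fdval_det_le// E; exact: subset_refl.
Qed.

Lemma fdval_det_class (p : vertex nu n) g h : g \in unitmx -> h \in unitmx ->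
  vclass p (lat g) -> vclass p (lat h) ->
  exists k : int, v (\det h) = k * n%:Z + v (\det g).
Proof.
move=> gU hU /vclassE -> [a /= a0]; rewrite scale_set_val_lattice => E.
exists (v a); rewrite -(@fdval_det_eq (a *: g) h) ?unitmxZl// fdval_detZ//.
by rewrite -mulr_natr natz.
Qed.

Lemma vtypeE (p : vertex nu n) g : g \in unitmx -> vclass p (lat g) ->
  vtype p = (v (\det g) %% n)%Z :> int.
Proof.
move=> gU pg.
have ge0 : 0 <= (v (\det g) %% n)%Z.
  case: (posnP n) => [n0|n0]; last by rewrite modz_ge0//; lia.
  have -> : v (\det g) = 0; last by rewrite mod0z.
  move: g {gU pg}; rewrite n0 => g.
  by rewrite det_mx00 [LHS]fdval1.
have /xgetPex : [set i : nat | exists g, [/\ g \in unitmx, vclass p (lat g)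
    & (i : int) = (fine (nu (\det g)) %% n)%Z]] !=set0.
  by exists `|(v (\det g) %% n)%Z|%N; exists g; split => //; rewrite gez0_abs.
move=> /(_ 0%N) [h [hU ph E]]; rewrite /vtype E.
by have [k ->] := fdval_det_class hU gU ph pg; rewrite modzMDl.
Qed.

Lemma vtype_lt (p : vertex nu n) : (0 < n)%N -> (vtype p < n)%N.
Proof.
move=> n0; have [g [gU pg]] := vclass_ex p.
rewrite -ltz_nat (vtypeE gU pg) ltz_pmod//.
Qed.

Lemma vtype_inj (S : set (vertex nu n)) p q : is_simplex S -> S p -> S q ->
  vtype p = vtype q -> p = q.
Proof.
move=> [m [w [L [pi [[_ ->] pi1 wL Lmono Lmax]]]]] [i _ <-] [j _ <-] {p q}.
have pi0 : pi != 0 by apply: contra_eqN pi1 => /eqP->; rewrite dval0.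
have vpi : v pi^-1 = -1 by rewrite [LHS]fdvalV// pi1.
wlog ij : i j / (i <= j)%N.
  move=> H tij; have [ij|/ltnW ji] := leqP i j; first exact: H.
  by apply/esym/H.
move=> tij.
have [gi [giU gE _]] := vclass_lat (wL i).
have [gj [gjU hE _]] := vclass_lat (wL j).
have ij' : lat gi `<=` lat gj by rewrite -gE -hE; exact: Lmono.
have jm : lat gj `<=` lat (pi^-1 *: gi).
  rewrite -scale_set_val_lattice -gE -hE => x /(Lmono j ord_max (leq_ord _)).
  move=> /Lmax [y Ly <-]; exists y => //.
  by move: y Ly; apply: Lmono.
have i0 : pi^-1 != 0 by rewrite invr_neq0.
have giU' : pi^-1 *: gi \in unitmx by rewrite unitmxZl.
have d1 := fdval_det_le gjU giU ij'.
have d2 := fdval_det_le giU' gjU jm.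
rewrite fdval_detZ// vpi in d2.
have : (v (\det gi) %% n)%Z = (v (\det gj) %% n)%Z.
  have wi := wL i; have wj := wL j; rewrite gE in wi; rewrite hE in wj.
  by rewrite -(vtypeE giU wi) -(vtypeE gjU wj) tij.
move=> /eqP; rewrite eqz_mod_dvd => /dvdzP[k kE].
have : (v (\det gi) == v (\det gj)) || (v (\det gi) == n%:Z + v (\det gj)).
  move: d2; rewrite mulNrn natz => d2.
  have : (k == 0) || (k == 1) || (n == 0%N) by nia.
  by case/orP => [/orP[]|] /eqP E; apply/orP; nia.
case/orP => /eqP E.
  have := wL i; rewrite gE (val_lattice_eq gjU giU ij' (esym E)) -hE => wi.
  exact: vclass_inj wi (wL j).
have E' : v (\det (pi^-1 *: gi)) = v (\det gj).
  by rewrite fdval_detZ// vpi E mulNrn natz; lia.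
have := wL j; rewrite hE (val_lattice_eq giU' gjU jm E').
rewrite -scale_set_val_lattice => wj; apply/esym; apply: vclass_inj wj _.
by apply: vclass_scale => //; rewrite -gE.
Qed.

Lemma simplex_finite (S : set (vertex nu n)) : is_simplex S -> finite_set S.
Proof.
by move=> [m [w [L [pi [[_ ->] _ _ _ _]]]]]; exact: finite_image.
Qed.

End LatticeTheory.

Section RealizationTheory.
Context (R : realType) (K : fieldType) (nu : discrete_valuation K) (n : nat).
Local Notation vert := (vertex nu n).
Local Notation X := (building R nu n).
Implicit Types (x y z : X) (S : set vert).

Lemma building_ext x y : (forall v, x v = y v) -> x = y.
Proof.
case: x y => [f f0 fS f1] [g g0 gS g1] /= /funext E; subst g.
by congr Building; exact: Prop_irrelevance.
Qed.

Lemma sum_simplex S (f : vert -> R) : is_simplex S ->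
  (forall w, ~ S w -> f w = 0) ->
  \sum_(w \in [set: vert]) f w = \sum_(w <- fset_set S) f w.
Proof.
move=> hS f0; apply: fsbigTE => w wS; apply: f0 => Sw; move: wS.
by rewrite in_fset_set ?mem_set//; exact: simplex_finite.
Qed.

Lemma in_simplex0 S x w : in_simplex S x -> ~ S w -> x w = 0.
Proof. by move=> Sx nS; apply: contra_notP nS => /eqP/Sx. Qed.

Let F x k : R := \sum_(w \in [set: vert]) x w * (k < vtype w)%:R.

Let F_fset S x k : is_simplex S -> in_simplex S x ->
  F x k = \sum_(w <- fset_set S) x w * (k < vtype w)%:R.
Proof.
by move=> hS Sx; apply: sum_simplex => // w nS; rewrite (in_simplex0 Sx)// mul0r.
Qed.

Let pick_type S x w : is_simplex S -> in_simplex S x -> S w ->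
  \sum_(u <- fset_set S) x u * (vtype u == vtype w)%:R = x w.
Proof.
move=> hS Sx Sw; have fS := simplex_finite hS.
rewrite (big_fsetD1 w)/=; last by rewrite in_fset_set// mem_set.
rewrite eqxx mulr1 big_seq big1 ?addr0// => u.
rewrite in_fsetD1 in_fset_set// => /andP[uw /set_mem Su].
case: eqP => [E|]; rewrite ?mulr0//.
by rewrite (vtype_inj hS Su Sw E) eqxx in uw.
Qed.

Let F_pos S x w t : is_simplex S -> in_simplex S x -> S w ->
  vtype w = t.+1 -> x w = F x t - F x t.+1.
Proof.
move=> hS Sx Sw wt; rewrite !(F_fset _ hS Sx) -sumrB -(pick_type hS Sx Sw).
apply: eq_bigr => u _; rewrite -mulrBr wt; congr (_ * _).
have -> : (t < vtype u)%N = (t.+1 < vtype u)%N || (vtype u == t.+1).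
  by rewrite leq_eqVlt eq_sym orbC.
case: eqP => [->|_]; first by rewrite ltnn subr0.
by rewrite orbF subrr.
Qed.

Let F_0 S x w : is_simplex S -> in_simplex S x -> S w ->
  vtype w = 0%N -> x w = 1 - F x 0%N.
Proof.
move=> hS Sx Sw wt; rewrite -(bary_sum x) (sum_simplex hS); last first.
  by move=> u; exact: in_simplex0.
rewrite (F_fset _ hS Sx) -sumrB -(pick_type hS Sx Sw).
apply: eq_bigr => u _; rewrite wt.
by case: (vtype u) => [|k] /=; rewrite ?mulr0 ?mulr1 ?subr0 ?subrr.
Qed.

Let F_last x : (0 < n)%N -> F x n.-1 = 0.
Proof.
move=> n0; rewrite /F fsbig1// => w _.
by rewrite ltnNge -ltnS prednK// vtype_lt// mulr0.
Qed.

Lemma apt_norm_ge0 (a : 'rV[R]_n) : 0 <= apt_norm a.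
Proof. exact: sqrtr_ge0. Qed.

Lemma apt_normN (a : 'rV[R]_n) : apt_norm (- a) = apt_norm a.
Proof.
rewrite /apt_norm; congr (Num.sqrt _); apply: eq_bigr => i _.
rewrite (eq_bigr (fun j => - a 0 j)) => [|j _]; last by rewrite mxE.
by rewrite sumrN mxE mulNr -opprD sqrrN.
Qed.

Lemma apt_norm_coord (a : 'rV[R]_n) i j : `|a 0 i - a 0 j| <= 2 * apt_norm a.
Proof.
set m := (\sum_j a 0 j) / n%:R.
have H k : `|a 0 k - m| <= apt_norm a.
  rewrite -sqrtr_sqr ler_wsqrtr// (bigD1 k)//= lerDl.
  by apply: sumr_ge0 => *; exact: sqr_ge0.
have -> : a 0 i - a 0 j = (a 0 i - m) - (a 0 j - m) by rewrite opprB addrA subrK.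
by rewrite (le_trans (ler_normB _ _))// mulr_natl mulr2n lerD.
Qed.

Lemma bary_lipschitz S x y w : is_simplex S -> in_simplex S x ->
  in_simplex S y -> `|x w - y w| <= 2 * apt_norm (folding x - folding y).
Proof.
move=> hS Sx Sy; have [Sw|nS] := pselect (S w); last first.
  by rewrite !(in_simplex0 _ nS)// subrr normr0 mulr_ge0// apt_norm_ge0.
have zE (i : 'I_n) : (folding x - folding y) 0 i = F x i - F y i.
  by rewrite !mxE.
case: (posnP n) => [n0|n0].
  have t0 (u : vert) : vtype u = 0%N.
    have [g [gU pg]] := vclass_ex u; apply/eqP.
    rewrite -eqz_nat (vtypeE gU pg); move: g {gU pg}; rewrite n0 => g.
    by rewrite det_mx00 fdval1 mod0z.
  have F0 z : F z 0%N = 0 by rewrite /F fsbig1// => u _; rewrite t0 mulr0.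
  rewrite (F_0 hS Sx Sw)// (F_0 hS Sy Sw)// !F0 subrr normr0.
  by rewrite mulr_ge0// apt_norm_ge0.
case tE : (vtype w) => [|t].
  have l0 : (n.-1 < n)%N by rewrite prednK.
  have := apt_norm_coord (folding x - folding y) (Ordinal n0) (Ordinal l0).
  rewrite !zE /= !F_last// !subr0 => H.
  rewrite (F_0 hS Sx Sw)// (F_0 hS Sy Sw)//.
  have -> : 1 - F x 0 - (1 - F y 0) = - (F x 0 - F y 0) by ring.
  by rewrite normrN.
have tn : (t.+1 < n)%N by rewrite -tE vtype_lt.
have := apt_norm_coord (folding x - folding y) (Ordinal (ltnW tn)) (Ordinal tn).
rewrite !zE /= => H.
rewrite (F_pos hS Sx Sw tE) (F_pos hS Sy Sw tE).
suff -> : F x t - F x t.+1 - (F y t - F y t.+1) =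
  F x t - F y t - (F x t.+1 - F y t.+1) by [].
by ring.
Qed.

Lemma chain_ge0 x y l : chain x y l -> 0 <= l.
Proof. by elim=> // S a b c k _ _ _ _ k0; rewrite addr_ge0// apt_norm_ge0. Qed.

Lemma chain_lipschitz x y l w : chain x y l -> `|x w - y w| <= 2 * l.
Proof.
elim=> [a|S a b c k hS Sa Sb _ IH]; first by rewrite subrr normr0 mulr0.
rewrite -(subrK (b w) (a w)) -addrA (le_trans (ler_normD _ _))// mulrDr.
by rewrite lerD// (bary_lipschitz _ hS).
Qed.

Lemma chain_cat x y z k l : chain x y k -> chain y z l -> chain x z (k + l).
Proof.
move=> h; elim: h z l => [a|S a b c m hS Sa Sb _ IH] z l; first by rewrite add0r.
by move=> cz; rewrite -addrA; apply: (chain_cons hS Sa Sb); exact: IH.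
Qed.

Lemma chain_step S x y : is_simplex S -> in_simplex S x -> in_simplex S y ->
  chain x y (apt_norm (folding x - folding y)).
Proof.
move=> hS Sx Sy; rewrite -[apt_norm _]addr0.
exact: (chain_cons hS Sx Sy (chain_nil y)).
Qed.

Lemma chain_sym x y l : chain x y l -> chain y x l.
Proof.
elim=> [a|S a b c m hS Sa Sb _ IH]; first exact: chain_nil.
rewrite addrC; apply: chain_cat IH _.
by rewrite -apt_normN opprB; exact: chain_step hS Sb Sa.
Qed.

End RealizationTheory.

Lemma unitmx_lup_ind (F : fieldType) n (P : 'M[F]_n -> Prop) :
  (forall A B, P A -> P B -> P (A *m B)) ->
  (forall L : 'M[F]_n,
     (forall i j : 'I_n, (i <= j)%N -> L i j = (i == j)%:R) -> P L) ->
  (forall U : 'M[F]_n, U \in unitmx ->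
     (forall i j : 'I_n, (j < i)%N -> U i j = 0) -> P U) ->
  (forall s : {perm 'I_n}, P (perm_mx s)) ->
  forall A, A \in unitmx -> P A.
Proof.
case: n P => [|n] P Pmul Plow Pupp Pperm A AU.
  by apply: Plow => -[].
have := cormen_lup_correct A; have := cormen_lup_perm A.
have := cormen_lup_lower A; have := cormen_lup_upper A.
case: (cormen_lup A) => [[Q L] U] /= HU HL /is_perm_mxP[s ->] E.
have LU : L *m U = perm_mx s *m A by rewrite [perm_mx s *m A]E.
have -> : A = perm_mx s^-1%g *m (L *m U).
  by rewrite LU mulmxA -perm_mxM mulVg perm_mx1 mul1mx.
apply: (Pmul) => //; apply: (Pmul); first exact: Plow.
apply: Pupp => //.
have : L *m U \in unitmx by rewrite LU unitmx_mul unitmx_perm.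
by rewrite unitmx_mul => /andP[].
Qed.

Section Connectedness.
Context (R : realType) (K : fieldType) (nu : discrete_valuation K) (n : nat).
Local Notation vert := (vertex nu n).
Local Notation X := (building R nu n).
Local Notation O := (val_ring nu).
Local Notation lat := (@val_lattice K nu n).
Let v a : int := fine (nu a).
Let vM a b : a != 0 -> b != 0 -> v (a * b) = v a + v b := @fdvalM _ nu a b.
Let vV a : a != 0 -> v a^-1 = - v a := @fdvalV _ nu a.
Let vO a : a != 0 -> (a \in O) = (0 <= v a) := @val_ringE _ nu a.
Implicit Types (x y z : X) (S : set vert) (g h u : 'M[K]_n).

Lemma uniformizerP (pi : K) : nu pi = 1%:E -> pi != 0 /\ pi \in O.
Proof.
move=> pi1; split; last by rewrite unfold_in /val_ring pi1 lee_fin.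
by apply: contra_eqN pi1 => /eqP->; rewrite dval0.
Qed.

Lemma is_simplex1 (p : vert) : is_simplex [set p].
Proof.
have [g [gU pg]] := vclass_ex p.
have [pi pi1] := dval_uniformizer nu; have [pi0 piO] := uniformizerP pi1.
exists 0%N, (fun=> p), (fun=> lat g), pi; split => //.
- split; first by move=> i j _; rewrite [i]ord1 [j]ord1.
  by apply/seteqP; split => [q ->|_ [_ _ <-]//]; exists ord0.
- by move=> i j _; exact: subset_refl.
- rewrite /= scale_set_val_lattice; apply: (@val_lattice_sub _ _ _ _ _ pi%:M).
    by rewrite mul_scalar_mx scalerA mulfV// scale1r.
  by rewrite mxOver_scalar// rpred0.
Qed.

Lemma dirac_sum (p : vert) : \sum_(w \in [set: vert]) ((w == p)%:R : R) = 1.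
Proof.
rewrite (sum_simplex (is_simplex1 p)); last by move=> w /eqP/negbTE->.
by rewrite fset_set1 big_seq_fset1 eqxx.
Qed.

Definition vpoint (p : vert) : X.
Proof.
refine (@Building R K nu n (fun w => (w == p)%:R) _ _ (dirac_sum p)).
- by move=> w; rewrite ler0n.
- exists [set p]; first exact: is_simplex1.
  by move=> w; rewrite pnatr_eq0 eqb0 negbK => /eqP.
Defined.

Lemma in_simplex_vpoint S p : S p -> in_simplex S (vpoint p).
Proof. by move=> Sp w /=; rewrite pnatr_eq0 eqb0 negbK => /eqP->. Qed.

Definition conn x y := exists l, chain x y l.

Lemma conn_sym x y : conn x y -> conn y x.
Proof. by move=> [l /chain_sym]; exists l. Qed.

Lemma conn_trans y x z : conn x y -> conn y z -> conn x z.
Proof. by move=> [k xy] [l yz]; exists (k + l); exact: chain_cat xy yz. Qed.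

Lemma conn_vpoint x : exists p, conn x (vpoint p).
Proof.
have [p xp] : exists p, x p != 0.
  apply/not_existsP => x0; have := bary_sum x; rewrite fsbig1.
    by move/esym/eqP; rewrite oner_eq0.
  by move=> p _; apply/eqP/negPn/negP/x0.
have [S hS Sx] := bary_simplex x.
by exists p; eexists; apply: (chain_step hS Sx); exact: in_simplex_vpoint (Sx _ xp).
Qed.

Let rconn g h := forall p q, vclass p (lat g) -> vclass q (lat h) ->
  conn (vpoint p) (vpoint q).

Let P u := u \in unitmx /\ forall g, g \in unitmx -> rconn (u *m g) g.

Let vclass_mkv g (gU : g \in unitmx) : vclass (mkv nu gU) (lat g).
Proof.
by exists 1; rewrite /= ?oner_neq0// scale_set_val_lattice scale1r.
Qed.

Let conn_refl x : conn x x. Proof. exists 0; exact: chain_nil. Qed.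

Let P_mul u w : P u -> P w -> P (u *m w).
Proof.
move=> [uU Pu] [wU Pw]; split; first by rewrite unitmx_mul uU.
move=> g gU p q pg qg; have wgU : w *m g \in unitmx by rewrite unitmx_mul wU.
apply: (@conn_trans (vpoint (mkv nu wgU))).
  by apply: (Pu (w *m g)) => //; rewrite mulmxA.
exact: (Pw g).
Qed.

Let P_inv u : P u -> P (invmx u).
Proof.
move=> [uU Pu]; split; first by rewrite unitmx_inv.
move=> g gU p q pg qg; apply: conn_sym.
apply: (Pu (invmx u *m g)) => //; first by rewrite unitmx_mul unitmx_inv uU.
by rewrite mulKVmx.
Qed.

Let P_O u w : u \is a mxOver O -> w \is a mxOver O -> u *m w = 1%:M -> P u.
Proof.
move=> uO wO uw; have [uU wU] := mulmx1_unit uw; split => // g gU p q pg qg.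
suff -> : p = q by [].
apply: vclass_inj pg _; suff -> : lat (u *m g) = lat g by [].
apply/seteqP; split; first exact: (val_lattice_sub (erefl (u *m g))).
by apply: (@val_lattice_sub _ _ _ _ _ w) => //; rewrite mulmxA (mulmx1C uw) mul1mx.
Qed.

Let P_scalar a : a != 0 -> P a%:M.
Proof.
move=> a0; split; first by rewrite unitmxE det_scalar unitfE expf_neq0.
move=> g gU p q; rewrite mul_scalar_mx -scale_set_val_lattice => pg qg.
suff -> : p = q by [].
by apply: vclass_inj pg _; exact: vclass_scale.
Qed.

Let P_edge u w pi : nu pi = 1%:E -> u \is a mxOver O -> w \is a mxOver O ->
  u *m w = pi%:M -> P u.
Proof.
move=> pi1 uO wO uw; have [pi0 piO] := uniformizerP pi1.
have uw1 : u *m (pi^-1 *: w) = 1%:M.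
  by rewrite -scalemxAr uw scale_scalar_mx mulVf.
have [uU wU] := mulmx1_unit uw1; split => // g gU p q pg qg.
have [->|pq] := eqVneq p q; first exact: conn_refl.
pose V (i : 'I_2) := if i == ord0 then p else q.
pose L (i : 'I_2) := if i == ord0 then lat (u *m g) else lat g.
have S : is_simplex (range V).
  exists 1%N, V, L, pi; split => //.
  - split => // i j; rewrite /V.
    case: eqP => [->|/eqP i0]; case: eqP => [->|/eqP j0] // E.
    + by rewrite E eqxx in pq.
    + by rewrite E eqxx in pq.
    + by apply/val_inj; case: i j i0 j0 {E} => -[|[|//]] ? [[|[|//]] ?].
  - by move=> j; rewrite /V /L; case: eqP.
  - move=> i j ij; rewrite /L; case: eqP => [_|i0]; case: eqP => [j0|_] //.
      exact: (val_lattice_sub (erefl (u *m g))).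
    by exfalso; apply/i0/val_inj/eqP; move: ij; rewrite j0 leqn0.
  - rewrite /L /= scale_set_val_lattice.
    apply: (@val_lattice_sub _ _ _ _ _ w) => //.
    by rewrite -scalemxAr scalemxAl mulmxA (mulmx1C uw1) mul1mx.
eexists; apply: (chain_step S); apply: in_simplex_vpoint.
- by exists ord0.
- by exists ord_max.
Qed.

Let diag_ok (d : 'rV[K]_n) := forall i, d 0 i != 0.

Let diag_inv (d : 'rV[K]_n) : diag_ok d ->
  diag_mx d *m diag_mx (map_mx GRing.inv d) = 1%:M.
Proof.
move=> d0; rewrite mulmx_diag -diag_const_mx; congr diag_mx.
by apply/rowP => i; rewrite !mxE mulfV.
Qed.

Let diagO (d : 'rV[K]_n) : (forall i, d 0 i \in O) -> diag_mx d \is a mxOver O.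
Proof.
by move=> dO; rewrite mxOver_diag ?rpred0//; apply/mxOverP => i j; rewrite ord1.
Qed.

Let P_diag_bounded N (d : 'rV[K]_n) : diag_ok d ->
  (forall i, 0 <= v (d 0 i) <= N%:Z) -> P (diag_mx d).
Proof.
have [pi pi1] := dval_uniformizer nu; have [pi0 piO] := uniformizerP pi1.
have vpi : v pi = 1 by rewrite /v pi1.
elim: N d => [|N IH] d d0 dN.
  apply: (P_O _ _ (diag_inv d0)); apply: diagO => i; rewrite ?mxE.
    by rewrite vO//; case/andP: (dN i).
  rewrite vO ?invr_neq0// vV//; have := dN i.
  by move: (v _) => t; lia.
pose d' := \row_i (if 0 < v (d 0 i) then d 0 i / pi else d 0 i).
pose d'' := \row_(i < n) (if 0 < v (d 0 i) then pi else 1).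
pose e := \row_(i < n) (if 0 < v (d 0 i) then 1 else pi).
have -> : diag_mx d = diag_mx d'' *m diag_mx d'.
  rewrite mulmx_diag; congr diag_mx; apply/rowP => i; rewrite !mxE.
  by case: ifP => _; rewrite ?mul1r// mulrCA mulfV// mulr1.
apply: P_mul.
  apply: (@P_edge _ (diag_mx e) pi pi1).
  - by apply: diagO => i; rewrite mxE; case: ifP => _ //; exact: rpred1.
  - by apply: diagO => i; rewrite mxE; case: ifP => _ //; exact: rpred1.
  - rewrite mulmx_diag -diag_const_mx; congr diag_mx; apply/rowP => i.
    by rewrite !mxE; case: ifP => _; rewrite ?mulr1 ?mul1r.
apply: IH => i; rewrite mxE; case: ifP => h //.
- by rewrite mulf_neq0// invr_neq0.
- rewrite vM ?invr_neq0// vV// vpi.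
  by have := dN i; move: h; lia.
- by have := dN i; move: h; lia.
Qed.

Let P_diag (d : 'rV[K]_n) : diag_ok d -> P (diag_mx d).
Proof.
move=> d0.
have [pi pi1] := dval_uniformizer nu; have [pi0 piO] := uniformizerP pi1.
have vpi : v pi = 1 by rewrite /v pi1.
pose N := (\sum_i absz (v (d 0%R i)))%N.
have vN : v (pi ^+ N) = N%:Z by rewrite [LHS]fdvalX// [fine _]vpi natz.
have -> : diag_mx d = (pi ^+ N)^-1%:M *m diag_mx (pi ^+ N *: d).
  rewrite mul_scalar_mx; apply/matrixP => i j; rewrite !mxE.
  by case: eqP => _; rewrite ?mulr0n ?mulr0// !mulr1n mulrA mulVf ?mul1r ?expf_neq0.
apply: P_mul; first by apply: P_scalar; rewrite invr_neq0 ?expf_neq0.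
apply: (@P_diag_bounded (N + N)%N) => i; rewrite mxE.
  by rewrite mulf_neq0 ?expf_neq0.
rewrite vM ?expf_neq0// vN.
have : (absz (v (d 0%R i)) <= N)%N by rewrite /N (bigD1 i)//= leq_addr.
move: (v _) N {vN} => t N; lia.
Qed.

Let P_unitri (A : 'M[K]_n) (f : 'I_n -> nat) : \det A = 1 ->
  (forall i, A i i = 1) ->
  (forall i j, i != j -> A i j != 0 -> (f j < f i)%N) -> P A.
Proof.
move=> dA A1 Af.
have [pi pi1] := dval_uniformizer nu; have [pi0 piO] := uniformizerP pi1.
have vpi : v pi = 1 by rewrite /v pi1.
have vX k : v (pi ^+ k) = k%:Z by rewrite [LHS]fdvalX// [fine _]vpi natz.
pose N := (\sum_i \sum_j `|v (A i j)|)%N.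
have AN i j : (`|v (A i j)| <= N)%N.
  by rewrite /N (bigD1 i)//= (bigD1 j)//= -addnA leq_addr.
pose d := \row_(i < n) pi ^+ (N * f i).
have d0 : diag_ok d by move=> i; rewrite mxE expf_neq0.
pose D := diag_mx d; pose D' := diag_mx (map_mx GRing.inv d).
have DD' : D *m D' = 1%:M by exact: diag_inv.
have D'D : D' *m D = 1%:M by exact: mulmx1C.
have -> : A = D' *m ((D *m A *m D') *m D).
  by rewrite -!mulmxA D'D mulmx1 mulmxA D'D mul1mx.
have PD : P D by exact: P_diag.
have PD' : P D'.
  by apply: P_diag => i; rewrite mxE invr_neq0.
apply: P_mul => //; apply: P_mul => //.
set B := D *m A *m D'.
have dB : \det B = 1.
  by rewrite !det_mulmx mulrAC -det_mulmx DD' det1 mul1r.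
have BO : B \is a mxOver O.
  apply/mxOverP => i j; rewrite /B /D' mul_mx_diag /D mul_diag_mx !mxE.
  have [<-|ij] := eqVneq i j.
    by rewrite A1 mulr1 mulfV ?rpred1// expf_neq0.
  have [->|Aij] := eqVneq (A i j) 0; first by rewrite mulr0 mul0r rpred0.
  have fij := Af _ _ ij Aij.
  rewrite vO ?mulf_neq0 ?invr_neq0 ?expf_neq0//.
  rewrite !vM ?mulf_neq0 ?invr_neq0 ?expf_neq0// vV ?expf_neq0//.
  rewrite !vX; have := AN i j.
  have : (N + N * f j <= N * f i)%N by rewrite -mulnS leq_mul2l fij orbT.
  move: (v _) N (f i) (f j) {fij AN d d0 D D' DD' D'D PD PD' B dB} => t N' a b.
  lia.
have BU : B \in unitmx by rewrite unitmxE dB unitr1.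
apply: (@P_O _ (invmx B)) => //; last exact: mulmxV.
by apply: invmx_mxOver => //; rewrite dB fdval1.
Qed.

Let P_unit (A : 'M[K]_n) : A \in unitmx -> P A.
Proof.
have lowP (L : 'M[K]_n) : (forall i j : 'I_n, (i <= j)%N -> L i j = (i == j)%:R) ->
    P L.
  move=> HL; apply: (@P_unitri _ (fun i => i)).
  - have tL : is_trig_mx L.
      apply/is_trig_mxP => i j ij; rewrite (HL _ _ (ltnW ij)).
      by rewrite (negbTE (_ : i != j))// -val_eqE neq_ltn ij.
    by rewrite (det_trig tL) big1// => i _; rewrite (HL _ _ (leqnn i)) eqxx.
  - by move=> i; rewrite (HL _ _ (leqnn i)) eqxx.
  - move=> i j ij; rewrite ltnNge; apply: contra => ji.
    by rewrite (HL _ _ ji) (negbTE ij).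
have uppP (U : 'M[K]_n) : U \in unitmx ->
    (forall i j : 'I_n, (j < i)%N -> U i j = 0) -> P U.
  move=> UU HU.
  have detU (W : 'M[K]_n) : (forall i j : 'I_n, (j < i)%N -> W i j = 0) ->
      \det W = \prod_i W i i.
    move=> HW; rewrite -det_tr det_trig; first by apply: eq_bigr => i; rewrite mxE.
    by apply/is_trig_mxP => i j ij; rewrite mxE HW.
  have d0 : diag_ok (\row_i U i i).
    move=> i; rewrite mxE; move: UU; rewrite unitmxE detU// unitfE.
    by move/prodf_neq0; exact.
  pose U' := diag_mx (map_mx GRing.inv (\row_i U i i)) *m U.
  have U'E i j : U' i j = (U i i)^-1 * U i j by rewrite /U' mul_diag_mx !mxE.
  have -> : U = diag_mx (\row_i U i i) *m U'.
    by rewrite mulmxA diag_inv// mul1mx.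
  apply: P_mul; first exact: P_diag.
  have U'1 i : U' i i = 1 by rewrite U'E mulVf//; have := d0 i; rewrite mxE.
  apply: (@P_unitri _ (fun i => (n - i)%N)) => //.
  - rewrite detU; first by rewrite big1.
    by move=> i j ij; rewrite U'E (HU _ _ ij) mulr0.
  - move=> i j ij Uij; have ji : (i < j)%N.
      rewrite ltn_neqAle val_eqE ij /= leqNgt; apply: contra Uij => ji.
      by rewrite U'E (HU _ _ ji) mulr0.
    by rewrite ltn_sub2l// (leq_ltn_trans _ (ltn_ord j))// ltnW.
have permP' (s : {perm 'I_n}) : P (perm_mx s).
  apply: (@P_O _ (perm_mx s^-1%g)).
  - by apply/mxOverP => i j; rewrite !mxE rpred_nat.
  - by apply/mxOverP => i j; rewrite !mxE rpred_nat.
  - by rewrite -perm_mxM mulgV perm_mx1.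
by move: A; apply: unitmx_lup_ind.
Qed.

Lemma building_connected x y : exists l, chain x y l.
Proof.
have [p xp] := conn_vpoint x; have [q yq] := conn_vpoint y.
apply: (conn_trans xp); apply: conn_trans (conn_sym yq).
have [g [gU pg]] := vclass_ex p; have [h [hU qh]] := vclass_ex q.
have [|_ H] := @P_unit (g *m invmx h); first by rewrite unitmx_mul gU unitmx_inv.
by apply: (H h) => //; rewrite mulmxKV.
Qed.

Local Notation dist := (@building_dist R K nu n).

Let has_inf_chain x y : has_inf [set l | chain x y l].
Proof.
split; first exact: building_connected.
by exists 0 => l /chain_ge0.
Qed.

Lemma building_dist_le x y l : chain x y l -> dist x y <= l.
Proof. by move=> xy; apply: ge_inf => //; have [] := has_inf_chain x y. Qed.

Lemma building_dist_ge0 x y : 0 <= dist x y.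
Proof.
by apply: lb_le_inf; [exact: building_connected|move=> l /chain_ge0].
Qed.

Lemma building_distxx x : dist x x = 0.
Proof.
apply/eqP; rewrite eq_le building_dist_ge0 andbT.
exact/building_dist_le/chain_nil.
Qed.

Lemma building_dist_sym x y : dist x y = dist y x.
Proof.
by congr inf; apply/seteqP; split => l; exact: chain_sym.
Qed.

Lemma building_dist_triangle y x z : dist x z <= dist x y + dist y z.
Proof.
rewrite -lerBlDr; apply: lb_le_inf; first exact: building_connected.
move=> k xy; rewrite lerBlDr -lerBlDl.
apply: lb_le_inf; first exact: building_connected.
move=> l yz; rewrite lerBlDl; exact/building_dist_le/(chain_cat xy yz).
Qed.

Lemma building_dist_positivity x y : dist x y = 0 -> x = y.
Proof.
move=> d0; apply: building_ext => w; apply/eqP.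
rewrite -subr_eq0 -normr_le0 -(mulr0 2) -d0 mulrC -ler_pdivrMr//.
apply: lb_le_inf; first exact: building_connected.
by move=> l /(@chain_lipschitz _ _ _ _ _ _ _ w); rewrite ler_pdivrMr// mulrC.
Qed.

HB.instance Definition _ := @isMetric.Build R X dist
  building_distxx building_dist_positivity building_dist_sym
  building_dist_triangle.

End Connectedness.

(* Main.v *)
(* Every lattice class is represented by diag(pi^e) m with m lower unitriangular
   and e 0 = 0.  The exponents e, a retraction onto an apartment, are Lipschitz.
   Cut the space of exponents into cells of a size s larger than the scale N.
   Replacing e by the corner of its cell, shifted by a multiple of s + N that
   depends on the row, moves a vertex by a bounded amount; and conjugation by
   the shifted diagonal matrix contracts the unipotent group so strongly that
   N-close vertices in the same cell are moved to the same vertex.  The fibres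
   of this coarsening map form a uniformly bounded cover, and the number of its
   members that meet a ball is at most the number of cells near the ball, which
   is at most 2^n. *)

Require Import Defs.
From HB Require Import structures.
From mathcomp Require Import all_boot all_order all_algebra.
From mathcomp Require Import all_classical all_reals all_analysis.
From mathcomp Require Import finmap zify lra.

Set Implicit Arguments.
Unset Strict Implicit.
Unset Printing Implicit Defensive.
Import Order.TTheory GRing.Theory Num.Theory.
Local Open Scope classical_set_scope.
Local Open Scope ring_scope.

(** * Lower unitriangular matrices and their quotients *)

Section Unitriangular.
Context {K : fieldType} (n : nat).
Implicit Types m : 'M[K]_n.

Definition unitri m :=
  (forall i j : 'I_n, (i < j)%N -> m i j = 0) /\ forall i, m i i = 1.

Lemma unitri_unitmx m : unitri m -> m \in unitmx.
Proof.
move=> [m0 m1]; rewrite unitmxE det_trig; last exact/is_trig_mxP.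
by rewrite big1 ?unitr1.
Qed.

(** Solve [w *m m = m'] column by column from the last one: above the diagonal, [m] kills the terms
    with [l < j] and the induction kills those with [l > j]. *)
Lemma unitri_quotient m m' : unitri m -> unitri m' -> unitri (m' *m invmx m).
Proof.
move=> mU [m'0 m'1]; have mu := unitri_unitmx mU; have [m0 m1] := mU.
set w := m' *m invmx m; have E : w *m m = m' by rewrite mulmxKV.
have w0 k : forall i j : 'I_n, (n - j < k)%N -> (i < j)%N -> w i j = 0.
  elim: k => // k IH i j jk ij.
  have := m'0 i j ij; rewrite -E mxE (bigD1 j)//= m1 mulr1 big1 ?addr0// => l lj.
  case: (ltngtP l j) => [lj'|jl|/val_inj E']; first by rewrite m0 ?mulr0.
    by rewrite IH ?mul0r//; have := ltn_ord l; lia.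
  by rewrite E' eqxx in lj.
have {}w0 (i j : 'I_n) : (i < j)%N -> w i j = 0 by apply: (w0 (n - j).+1).
split => // i; have := m'1 i; rewrite -E mxE (bigD1 i)//= m1 mulr1.
rewrite big1 ?addr0// => l li.
case: (ltngtP l i) => [il|il|/val_inj E']; first by rewrite m0 ?mulr0.
  by rewrite w0 ?mul0r.
by rewrite E' eqxx in li.
Qed.

End Unitriangular.

(** * Lattices with basis [diag(pi^e) m] and the Hermite normal form *)

Section NormalForm.
Context {K : fieldType} (nu : discrete_valuation K) (pi : K).
Context (pi1 : nu pi = 1%:E).
Local Notation O := (val_ring nu).
Let v (a : K) : int := fine (nu a).

Let vM a b : a != 0 -> b != 0 -> v (a * b) = v a + v b := @fdvalM _ nu a b.
Let vV a : a != 0 -> v a^-1 = - v a := @fdvalV _ nu a.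
Let v1 : v 1 = 0 := fdval1 nu.
Let vO a : a != 0 -> (a \in O) = (0 <= v a) := @val_ringE _ nu a.

Let pi0 : pi != 0.
Proof. by have [] := uniformizerP pi1. Qed.

Let piX0 (z : int) : pi ^ z != 0.
Proof. by rewrite expfz_neq0. Qed.

Lemma fdval_uniformizer (z : int) : fine (nu (pi ^ z)) = z.
Proof.
rewrite -[fine _]/(v (pi ^ z)).
have vX k : v (pi ^+ k) = k%:Z.
  by rewrite [LHS]fdvalX// [fine _](_ : _ = 1) ?natz// pi1.
case: z => k; first exact: vX.
by rewrite NegzE -exprnN vV ?expf_neq0// vX.
Qed.

Let vpi (z : int) : v (pi ^ z) = z := fdval_uniformizer z.

Lemma mxOver_scale_uniformizer m1 m2 (A : 'M[K]_(m1, m2)) :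
  exists k : nat, pi ^+ k *: A \is a mxOver O.
Proof.
pose c i j := (`|v (A i j)|)%N.
(* The sum of the absolute valuations bounds each of them; zero entries add nothing, since [fine]
   sends [+oo] to 0. *)
exists (\sum_i \sum_j c i j)%N; apply/mxOverP => i j; rewrite mxE.
have [->|A0] := eqVneq (A i j) 0; first by rewrite mulr0 rpred0.
rewrite vO ?mulf_neq0 ?expf_neq0// vM ?expf_neq0// (vpi (Posz _)).
have : (c i j <= \sum_i \sum_j c i j)%N.
  by rewrite (bigD1 i)//= (bigD1 j)//= -addnA leq_addr.
move: (\sum_i _)%N => N; rewrite /c; move: (v (A i j)) => t; lia.
Qed.

Section Fixed.
Context (n : nat).
Local Notation lat := (@val_lattice K nu n).
Implicit Types (m w g h : 'M[K]_n) (e f : 'I_n -> int).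

Definition pidiag e : 'M[K]_n := diag_mx (\row_i pi ^ e i).

Lemma pidiagE e m i j : (pidiag e *m m) i j = pi ^ e i * m i j.
Proof. by rewrite mul_diag_mx !mxE. Qed.

Lemma pidiagEr e m i j : (m *m pidiag e) i j = m i j * pi ^ e j.
Proof. by rewrite mul_mx_diag !mxE. Qed.

Lemma pidiagK e : pidiag e *m pidiag (fun i => - e i) = 1%:M.
Proof.
rewrite mulmx_diag -diag_const_mx; congr diag_mx; apply/rowP => i.
by rewrite !mxE -expfzDr// subrr expr0z.
Qed.

Lemma pidiag_unitmx e m : unitri m -> pidiag e *m m \in unitmx.
Proof.
move=> /unitri_unitmx mU; rewrite unitmx_mul mU andbT.
by have [] := mulmx1_unit (pidiagK e).
Qed.

Definition trilat e m := lat (pidiag e *m m).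

(** The change of basis has entries [pi^(f i - e j) * w i j] with [w = m' *m invmx m], and inclusion
    means that they are integral. Zero entries are set apart because [v] takes the default value 0
    there. *)
Lemma trilat_subP e f m m' : unitri m -> unitri m' ->
  trilat f m' `<=` trilat e m <->
  forall i j, (m' *m invmx m) i j != 0 -> e j <= f i + v ((m' *m invmx m) i j).
Proof.
move=> mU m'U; set w := m' *m invmx m.
have pU := pidiag_unitmx e mU.
pose u := pidiag f *m w *m pidiag (fun i => - e i).
have uE i j : u i j = pi ^ f i * w i j * pi ^ (- e j).
  by rewrite pidiagEr pidiagE.
have E : pidiag f *m m' = u *m (pidiag e *m m).
  rewrite /u -!mulmxA (mulmxA (pidiag (fun i => - e i))) (mulmx1C (pidiagK e)) mul1mx.
  by rewrite mulVmx ?mulmx1 ?unitri_unitmx.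
have uO : u \is a mxOver O <-> forall i j, w i j != 0 -> e j <= f i + v (w i j).
  split => [/mxOverP H i j w0|H].
    have := H i j; rewrite uE vO ?mulf_neq0// !vM ?mulf_neq0// !vpi; lia.
  apply/mxOverP => i j; rewrite uE.
  have [->|w0] := eqVneq (w i j) 0; first by rewrite mulr0 mul0r rpred0.
  have := H i j w0; rewrite vO ?mulf_neq0// !vM ?mulf_neq0// !vpi; lia.
rewrite -uO; split => [/(sub_val_lattice pU)|]; last exact: val_lattice_sub E.
by rewrite E mulmxK.
Qed.

Lemma trilat_sub_diag e f m m' i : unitri m -> unitri m' ->
  trilat f m' `<=` trilat e m -> e i <= f i.
Proof.
move=> mU m'U /(trilat_subP _ _ mU m'U) H; have := H i i.
have [_ ->] := unitri_quotient mU m'U.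
by rewrite oner_neq0 v1 addr0; exact.
Qed.

Lemma trilat_le e f m : unitri m -> (forall i, e i <= f i) ->
  trilat f m `<=` trilat e m.
Proof.
move=> mU ef; apply/(trilat_subP _ _ mU mU) => i j.
rewrite mulmxV ?unitri_unitmx// mxE.
by have [->|_] := eqVneq i j; rewrite ?eqxx// mulr1n v1 addr0.
Qed.

Lemma trilat_shift k e f m m' : unitri m -> unitri m' ->
  trilat f m' `<=` trilat e m ->
  trilat (fun i => f i + k) m' `<=` trilat (fun i => e i + k) m.
Proof.
move=> mU m'U /(trilat_subP _ _ mU m'U) H.
by apply/(trilat_subP _ _ mU m'U) => i j /H; lia.
Qed.

(** The scalars [a] and [pi ^ v a] differ by a unit of the valuation ring. *)
Lemma scale_trilat a e m : a != 0 ->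
  scale_set a (trilat e m) = trilat (fun i => e i + v a) m.
Proof.
move=> a0; rewrite /trilat scale_set_val_lattice.
have E c k g : c != 0 -> v c = k -> lat (c *: g) `<=` lat (pi ^ k *: g).
  move=> c0 ck; apply: (@val_lattice_sub _ _ _ _ _ (c * pi ^ (- k))%:M).
    by rewrite mul_scalar_mx scalerA -mulrA -expfzDr// addNr mulr1.
  by rewrite mxOver_scalar ?rpred0// vO ?mulf_neq0// vM// vpi ck subrr.
have -> : pidiag (fun i => e i + v a) *m m = pi ^ v a *: (pidiag e *m m).
  apply/matrixP => i j.
  by rewrite pidiagE expfzDr// [RHS]mxE pidiagE mulrA [pi ^ e i * _]mulrC.
apply/seteqP; split; first exact: E.
apply: (@val_lattice_sub _ _ _ _ _ (pi ^ v a / a)%:M).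
  by rewrite mul_scalar_mx scalerA -mulrA mulVf// mulr1.
rewrite mxOver_scalar ?rpred0// vO ?mulf_neq0 ?invr_neq0// vM ?invr_neq0//.
by rewrite vV// vpi subrr.
Qed.

(* Hermite normal form: row i of the basis is a vector of the lattice
   supported on the coordinates <= i whose i-th coordinate has least
   valuation. *)
Lemma val_lattice_trilat g : g \in unitmx ->
  exists e m, unitri m /\ lat g = trilat e m.
Proof.
move=> gU.
pose W (i : 'I_n) (z : int) (y : 'rV[K]_n) :=
  [/\ lat g y, forall j : 'I_n, (i < j)%N -> y 0 j = 0 & y 0 i = pi ^ z].
have latZ a y : a \in O -> lat g y -> lat g (a *: y).
  move=> aO [w /= wO <-]; exists (a *: w); last by rewrite scalemxAl.
  by apply/mxOverP => i j; rewrite mxE rpredM ?(mxOverP wO).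
have latB y z : lat g y -> lat g z -> lat g (y - z).
  move=> [w /= wO <-] [u /= uO <-]; exists (w - u); last by rewrite mulmxBl.
  exact: rpredB.
have latW y (i : 'I_n) : lat g y -> (forall j : 'I_n, (i < j)%N -> y 0 j = 0) ->
    y 0 i != 0 -> exists y', W i (v (y 0 i)) y'.
  move=> Ly y0 yi; exists ((pi ^ v (y 0 i) / y 0 i) *: y); split.
  - apply: latZ => //; rewrite vO ?mulf_neq0 ?invr_neq0// vM ?invr_neq0//.
    by rewrite vV// vpi subrr.
  - by move=> j ij; rewrite mxE (y0 _ ij) mulr0.
  - by rewrite mxE -mulrA mulVf// mulr1.
have [N /mxOverP gN] := mxOver_scale_uniformizer g.
(* This lower bound, due to the integrality of [pi ^+ N *: g], makes a least pivot valuation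
   exist. *)
have Wge i z y : W i z y -> - N%:Z <= z.
  move=> [[w /= wO <-] _ E].
  have : pi ^+ N * (w *m g) 0 i \in O.
    rewrite mxE big_distrr/=; apply: rpred_sum => k _.
    have := gN k i; rewrite mxE mulrCA => h.
    by apply: rpredM => //; exact: (mxOverP wO).
  rewrite E vO ?mulf_neq0 ?expf_neq0// vM ?expf_neq0// vpi (vpi (Posz _)).
  lia.
have Wex i : exists z y, W i z y.
  have [M gM] := mxOver_scale_uniformizer (invmx g).
  pose y := pi ^+ M *: delta_mx 0 i : 'rV[K]_n.
  have [|||y' Wy'] := latW y i _ _ _; last by eexists; eexists; exact: Wy'.
  - exists (row i (pi ^+ M *: invmx g)).
      by apply/mxOverP => a b; rewrite !mxE; have /mxOverP/(_ i b) := gM; rewrite mxE.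
    by rewrite -row_mul -scalemxAl mulVmx// /y rowE -scalemxAr mulmx1.
  - move=> j ij; rewrite !mxE /= (_ : (j == i) = false) ?mulr0//.
    by apply/negbTE; rewrite -val_eqE gtn_eqF.
  - by rewrite !mxE !eqxx mulr1 expf_neq0.
have Wmin i : exists z y, W i z y /\ forall z' y', W i z' y' -> z <= z'.
  have P : exists k, `[< exists y, W i (k%:Z - N%:Z) y >].
    have [z [y Wy]] := Wex i; exists (absz (z + N%:Z)); apply/asboolP; exists y.
    by have := Wge _ _ _ Wy => zN; rewrite gez0_abs ?addrK//; lia.
  have [/= k /asboolP[y Wy] kmin] := ex_minnP P.
  exists (k%:Z - N%:Z), y; split => // z' y' Wy'.
  have := Wge _ _ _ Wy' => zN.
  have := kmin (absz (z' + N%:Z)); rewrite gez0_abs; last by lia.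
  rewrite addrK => /(_ (introT (asboolP _) (ex_intro _ y' Wy'))); lia.
have [e /choice[y Wy]] := choice Wmin.
pose h := \matrix_(i, j) y i 0 j.
have hrow i : row i h = y i by apply/rowP => j; rewrite !mxE.
have hE i j : h i j = y i 0 j by rewrite mxE.
pose m := pidiag (fun i => - e i) *m h.
have mE : pidiag e *m m = h by rewrite mulmxA pidiagK mul1mx.
have mU : unitri m.
  split => [i j ij|i]; rewrite pidiagE hE; have [[_ y0 yi] _] := Wy i.
    by rewrite y0 ?mulr0.
  by rewrite yi -expfzDr// addNr.
exists e, m; split => //; rewrite /trilat mE.
have hU : h \in unitmx by rewrite -mE pidiag_unitmx.
have hg x : lat h x -> lat g x.
  move=> [w /= wO <-]; rewrite mulmx_sum_row.
  elim/big_ind : _ => [|a b La Lb|i _].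
  - by exists 0; rewrite /= ?mul0mx// rpred0.
  - rewrite -[b]opprK; apply: (latB _ _ La); rewrite -scaleN1r.
    by apply: latZ => //; rewrite rpredN rpred1.
  - by apply: latZ; rewrite ?(mxOverP wO)// hrow; case: (Wy i) => -[].
apply/seteqP; split => // x Lx; exists (x *m invmx h); last by rewrite mulmxKV.
set u := x *m invmx h; have uE : u *m h = x by rewrite mulmxKV.
(* The coefficients are shown integral from the last one down. Subtracting the rows after [i] leaves
   a lattice vector supported on the coordinates up to [i], with entry [u 0 i * pi ^ e i] at [i];
   minimality of [e i] then applies. *)
suff H k : forall i : 'I_n, (n - i < k)%N -> u 0 i \in O.
  by apply/mxOverP => a i; rewrite ord1; exact: (H (n - i).+1).
elim: k => // k IH i ik.
pose u' : 'rV[K]_n := \row_j (if (i < j)%N then u 0 j else 0).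
have u'O : u' \is a mxOver O.
  apply/mxOverP => a j; rewrite mxE; case: ltnP => ij; rewrite ?rpred0//.
  by apply: IH; have := ltn_ord j; lia.
pose z := x - u' *m h.
have Lz : lat g z by apply: latB => //; apply: hg; exists u'.
have zE (j : 'I_n) : z 0 j = \sum_(k < n | (k <= i)%N) u 0 k * h k j.
  rewrite /z -uE -mulmxBl mxE [RHS]big_mkcond; apply: eq_bigr => l _.
  by rewrite !mxE; case: ltnP => _; rewrite ?subrr ?mul0r// subr0.
have z0 (j : 'I_n) : (i < j)%N -> z 0 j = 0.
  move=> ij; rewrite zE big1// => l li; rewrite hE.
  by have [[_ yl _] _] := Wy l; rewrite yl ?mulr0// (leq_ltn_trans li).
have zi : z 0 i = u 0 i * pi ^ e i.
  rewrite zE (bigD1 i)//= big1 ?addr0 => [|l /andP[li lni]].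
    by rewrite hE; have [[_ _ ->]] := Wy i.
  rewrite hE; have [[_ yl _] _] := Wy l; rewrite yl ?mulr0//.
  by rewrite ltn_neqAle li andbT.
have [->|u0] := eqVneq (u 0 i) 0; first by rewrite rpred0.
have zi0 : z 0 i != 0 by rewrite zi mulf_neq0.
have [z' Wz'] := latW _ _ Lz z0 zi0.
have [_ /(_ _ _ Wz')] := Wy i.
by rewrite zi vM// vpi vO//; lia.
Qed.

End Fixed.
End NormalForm.

(** * Combinatorial closeness of vertices and the coarsening map *)

Section NearVertices.
Context {K : fieldType} (nu : discrete_valuation K) (pi : K) (n : nat).
Context (pi1 : nu pi = 1%:E).
Local Notation vert := (vertex nu n.+1).
Local Notation L := (@trilat K nu pi n.+1).
Implicit Types (p q r : vert) (N M : nat).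

Lemma vertex_trilat p : exists em : ('I_n.+1 -> int) * 'M[K]_n.+1,
  [/\ unitri em.2, em.1 ord0 = 0 & vclass p (L em.1 em.2)].
Proof.
have [g [gU pg]] := vclass_ex p.
have [e [m [mU E]]] := val_lattice_trilat pi1 gU; rewrite E in pg.
have a0 : pi ^ (- e ord0) != 0.
  by rewrite expfz_neq0//; have [] := uniformizerP pi1.
exists (fun i => e i + fine (nu (pi ^ (- e ord0))), m); split => //=.
  by rewrite fdval_uniformizer// subrr.
by rewrite -scale_trilat//; exact: vclass_scale.
Qed.

Definition vexp p := (projT1 (cid (vertex_trilat p))).1.
Definition vmx p := (projT1 (cid (vertex_trilat p))).2.

Lemma vmx_unitri p : unitri (vmx p).
Proof. by rewrite /vmx; case: cid => x []. Qed.

Lemma vexp0 p : vexp p ord0 = 0.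
Proof. by rewrite /vexp; case: cid => x []. Qed.

Lemma vclass_vexp p : vclass p (L (vexp p) (vmx p)).
Proof. by rewrite /vexp /vmx; case: cid => x []. Qed.

Lemma vclass_trilat p A : vclass p A ->
  exists k, A = L (fun i => vexp p i + k) (vmx p).
Proof.
rewrite (vclassE (vclass_vexp p)) => -[a /= a0 <-].
exists (fine (nu a)); exact: scale_trilat.
Qed.

(** Adding [N] to the exponents multiplies a lattice by [pi^N], so this is a lattice-theoretic
    substitute for a bound on the distance. *)
Definition vnear N p q :=
  L (fun i => vexp q i + N%:Z) (vmx q) `<=` L (vexp p) (vmx p) /\
  L (fun i => vexp p i + N%:Z) (vmx p) `<=` L (vexp q) (vmx q).

Lemma vnear_sym N p q : vnear N p q -> vnear N q p.
Proof. by case. Qed.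

Lemma vnear_trans N M q p r : vnear N p q -> vnear M q r -> vnear (N + M) p r.
Proof.
have H N' M' p' q' r' :
    L (fun i => vexp q' i + N'%:Z) (vmx q') `<=` L (vexp p') (vmx p') ->
    L (fun i => vexp r' i + M'%:Z) (vmx r') `<=` L (vexp q') (vmx q') ->
    L (fun i => vexp r' i + (N' + M')%:Z) (vmx r') `<=` L (vexp p') (vmx p').
  move=> h1 h2; apply: subset_trans h1; rewrite (_ : (fun i => _) =
    (fun i => vexp r' i + M'%:Z + N'%:Z)); last first.
    by apply/funext => i; lia.
  by apply: trilat_shift => //; exact: vmx_unitri.
move=> [a b] [c d]; split; first exact: H a c.
by rewrite addnC; exact: H d b.
Qed.

Lemma vnear_le N M p q : (N <= M)%N -> vnear N p q -> vnear M p q.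
Proof.
move=> NM [a b]; split; [apply: subset_trans a | apply: subset_trans b];
  by apply: trilat_le; [|exact: vmx_unitri|move=> i; rewrite lerD2l].
Qed.

Lemma simplex_vnear (S : set vert) p q : is_simplex S -> S p -> S q -> vnear 1 p q.
Proof.
move=> [k [w [A [pi' [[_ ->] pi'1 wA Amono Amax]]]]] [i _ <-] [j _ <-] {p q}.
wlog ij : i j / (i <= j)%N.
  move=> H; have [ij|/ltnW ji] := leqP i j; first exact: H.
  by apply/vnear_sym/H.
have [pi'0 _] := uniformizerP pi'1.
have [a aE] := vclass_trilat (wA i); have [b bE] := vclass_trilat (wA j).
have pU := vmx_unitri (w i); have qU := vmx_unitri (w j).
have h1 := Amono _ _ ij.
have h2 : A j `<=` scale_set pi'^-1 (A i).
  move=> x /(Amono j ord_max (leq_ord _)) /Amax [y Ay <-]; exists y => //.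
  by move: y Ay; apply: Amono.
rewrite aE in h1 h2; rewrite bE in h1 h2.
rewrite scale_trilat ?invr_neq0// in h2.
have v1 : fine (nu pi'^-1) = -1 by rewrite [LHS]fdvalV// pi'1.
rewrite v1 in h2.
(* Both zeroth exponents are 0, so the diagonal comparison at [ord0] gives [a - 1 <= b <= a]:
   passing to the normalised lattices costs at most one factor [pi]. *)
have := trilat_sub_diag pi1 ord0 qU pU h1.
have := trilat_sub_diag pi1 ord0 pU qU h2.
rewrite !vexp0 => ab ba.
move: h1 h2 => /(trilat_subP pi1 _ _ qU pU) h1 /(trilat_subP pi1 _ _ pU qU) h2.
split.
  by apply/(trilat_subP pi1 _ _ pU qU) => x y /h2; lia.
by apply/(trilat_subP pi1 _ _ qU pU) => x y /h1; lia.
Qed.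

(** Quotients of unitriangular matrices have diagonal 1, so the inclusions compare exponents
    directly. *)
Lemma vnear_vexp N p q i : vnear N p q -> `|vexp p i - vexp q i| <= N%:Z.
Proof.
move=> [/(trilat_sub_diag pi1 i (vmx_unitri _) (vmx_unitri _))].
move=> a /(trilat_sub_diag pi1 i (vmx_unitri _) (vmx_unitri _)); lia.
Qed.

(** The side is positive even for [N = 0]; at scale [N + N] it exceeds the width [2N] of the range
    of an exponent over a [vnear N] ball. *)
Definition cell N p (i : 'I_n.+1) := (vexp p i %/ (N.*2.+1)%:Z)%Z.

Definition coarse_exp N p (i : 'I_n.+1) :=
  cell N p i * (N.*2.+1)%:Z - ((n.+1 - i) * (N.*2.+1 + N))%:Z.

Lemma coarse_exp_bound N p i :
  coarse_exp N p i <= vexp p i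
    <= coarse_exp N p i + (N.*2.+1 + n.+1 * (N.*2.+1 + N))%:Z.
Proof.
rewrite /coarse_exp /cell.
have s0 : (N.*2.+1)%:Z != 0 by [].
have := divz_eq (vexp p i) (N.*2.+1)%:Z.
have := modz_ge0 (vexp p i) s0.
have := ltz_pmod (vexp p i) (isT : 0 < (N.*2.+1)%:Z).
have : ((n.+1 - i) * (N.*2.+1 + N) <= n.+1 * (N.*2.+1 + N))%N.
  by rewrite leq_mul2r leq_subr orbT.
move: (_ %% _)%Z (_ %/ _)%Z ((_ - _) * _)%N (n.+1 * _)%N => a b c d.
by lia.
Qed.

(* If w = vmx q * (vmx p)^-1, closeness bounds the valuations of the entries of
   w from below up to an error N; below the diagonal the weights
   (n.+1 - i) * (N.*2.+1 + N) absorb this error together with the size of a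
   cell. *)
Lemma vnear_coarse_sub N p q : vnear N p q -> cell N p =1 cell N q ->
  L (coarse_exp N q) (vmx q) `<=` L (coarse_exp N p) (vmx p).
Proof.
have pU := vmx_unitri p; have qU := vmx_unitri q.
move=> [/(trilat_subP pi1 _ _ pU qU) H _] pq.
apply/(trilat_subP pi1 _ _ pU qU) => i j w0.
have [w_lt w_diag] := unitri_quotient pU qU.
case: (ltngtP i j) => [ij|ji|/val_inj E].
- by rewrite w_lt ?eqxx in w0.
- have := H _ _ w0; move: (fine _) => t.
  have := coarse_exp_bound N p j; have := coarse_exp_bound N q i.
  rewrite /coarse_exp /cell.
  have s0 : (N.*2.+1)%:Z != 0 by [].
  have := divz_eq (vexp p j) (N.*2.+1)%:Z.
  have := modz_ge0 (vexp p j) s0.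
  have := divz_eq (vexp q i) (N.*2.+1)%:Z.
  have := ltz_pmod (vexp q i) (isT : 0 < (N.*2.+1)%:Z).
  have -> : (n.+1 - j = (n.+1 - i) + (i - j))%N.
    by have := ltn_ord i; lia.
  have : ((N.*2.+1 + N) <= (i - j) * (N.*2.+1 + N))%N.
    by rewrite leq_pmull// subn_gt0.
  rewrite mulnDl; move: ((i - j) * _)%N ((n.+1 - i) * _)%N => a b.
  move: (_ %% _)%Z (_ %/ _)%Z => a1 b1.
  move: (_ %% _)%Z (_ %/ _)%Z => a2 b2.
  lia.
(* The diagonal has no slack; there equal cells give equal exponents. *)
- by rewrite -E w_diag fdval1 addr0 /coarse_exp pq.
Qed.

Definition coarse N p : vert :=
  mkv nu (pidiag_unitmx pi1 (coarse_exp N p) (vmx_unitri p)).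

Lemma vclass_coarse N p : vclass (coarse N p) (L (coarse_exp N p) (vmx p)).
Proof.
by exists 1; rewrite /= ?oner_neq0// scale_set_val_lattice scale1r.
Qed.

Lemma vnear_coarse_eq N p q : vnear N p q -> cell N p =1 cell N q ->
  coarse N p = coarse N q.
Proof.
move=> pq c; apply: vclass_inj (vclass_coarse N p) _.
rewrite (_ : L _ _ = L (coarse_exp N q) (vmx q)); first exact: vclass_coarse.
apply/seteqP; split; last exact: vnear_coarse_sub.
by apply: vnear_coarse_sub => //; exact: vnear_sym.
Qed.

(* On a [vnear] ball each coordinate of [cell] takes at most two values. *)
Lemma coarse_vnear_card N p :
  ([set coarse (N + N) q | q in [set q | vnear N p q]]
    #<= `I_(#|{: {ffun 'I_n.+1 -> bool}}|))%card.
Proof.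
pose s := ((N + N).*2.+1)%:Z.
pose b i := ((vexp p i - N%:Z) %/ s)%Z.
(* The bit at [i] tells the lower of the two possible cells from the upper one. *)
pose key q := [ffun i => cell (N + N) q i == b i].
pose P k := [set q | vnear N p q /\ key q = k].
pose T := {ffun 'I_n.+1 -> bool}.
pose F i := coarse (N + N) (xget p (P (nth [ffun=> true] (enum T) i))).
apply: card_le_trans (card_image_le F _); apply: subset_card_le.
move=> _ [q /= pq <-]; exists (index (key q) (enum T)).
  by rewrite /= cardE index_mem mem_enum.
rewrite /F nth_index ?mem_enum//.
have /xgetPex -/(_ p)[pr kr] : P (key q) !=set0 by exists q.
set r := xget p _ in pr kr *.
(* Two vertices of the ball are only known to be [N + N] near, whence the scale of the
   coarsening. *)
have rq : vnear (N + N) r q by apply: vnear_trans pq; exact: vnear_sym.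
apply: vnear_coarse_eq => // i.
have s0 : 0 < s by [].
have cellE t : vnear N p t ->
    cell (N + N) t i = b i \/ cell (N + N) t i = b i + 1.
  move=> /(vnear_vexp i) pt.
  have h1 : b i <= cell (N + N) t i by apply: lez_pdiv2r => //; lia.
  have h2 : cell (N + N) t i <= b i + 1.
    rewrite addrC -divzMDl// mul1r; apply: lez_pdiv2r => //; rewrite /s; lia.
  lia.
move/ffunP/(_ i): kr; rewrite !ffunE.
by case: (cellE _ pr) => ->; case: (cellE _ pq) => -> //; rewrite ?eqxx; lia.
Qed.

End NearVertices.

(** * Comparison of the metric with combinatorial closeness *)

Section Realization.
Context (R : realType) {K : fieldType} (nu : discrete_valuation K) (pi : K).
Context (n : nat) (pi1 : nu pi = 1%:E).
Local Notation vert := (vertex nu n.+1).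
Local Notation X := (building R nu n.+1).
Local Notation vnear := (vnear pi1).
Implicit Types (x y z : X) (p q : vert).

(** The vertices of a simplex have distinct types, so there are at most [n.+1] of them, and their
    coordinates sum to 1. *)
Lemma building_peak x : exists p, n.+1%:R^-1 <= x p.
Proof.
apply/not_existsP => H.
have [S hS Sx] := bary_simplex x; have fS := simplex_finite hS.
have x_lt p : x p < n.+1%:R^-1 by rewrite ltNge; exact/negP/H.
have x0 p : ~ S p -> x p = 0 by move=> nS; exact: in_simplex0 Sx nS.
have := bary_sum x; rewrite (sum_simplex hS x0) => sum1.
have size_le : (size (fset_set S) <= n.+1)%N.
  have tinj : {in fset_set S &, injective (@vtype _ nu n.+1)}.
    move=> p q; rewrite !in_fset_set// => /set_mem Sp /set_mem Sq.
    exact: (vtype_inj hS Sp Sq).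
  rewrite -(size_map (@vtype _ nu n.+1)) -[leqRHS](size_iota 0).
  apply: uniq_leq_size; first by rewrite map_inj_in_uniq// fset_uniq.
  by move=> _ /mapP[p _ ->]; rewrite mem_iota add0n vtype_lt.
have [p Sp] : exists p, p \in fset_set S.
  case: (fset_0Vmem (fset_set S)) => [E|[p pS]]; last by exists p.
  by move: sum1 => /esym/eqP; rewrite E big_seq_fset0 oner_eq0.
have : \sum_(p <- fset_set S) x p < \sum_(p <- fset_set S) n.+1%:R^-1.
  apply: ltr_sum => [|p' _]; last exact: x_lt.
  by apply/hasP; exists p.
rewrite sum1 big_const_seq count_predT iter_addr_0 ltNge => /negP; apply.
by rewrite -[_ *+ _]mulr_natl ler_pdivrMr// mul1r ler_nat.
Qed.

(** Read the chain from its end [z], carrying a vertex [p] that was a peak when chosen; [t] is the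
    length travelled since. Coordinates are 2-Lipschitz, so that of [p] stays positive while
    [4 * n.+1 * t < 1]; after that a peak of the current point replaces [p]. Each replacement adds 1
    to [N] and uses up length at least [1/(4 * n.+1)], so [N] is controlled by the length and not by
    the number of pieces. *)
Lemma chain_vnear x z l q : chain x z l -> z q != 0 ->
  exists p N t, [/\ vnear N p q, n.+1%:R^-1 - 2 * t <= x p,
    0 <= t, 4 * n.+1%:R * t < 1 & N%:R <= 4 * n.+1%:R * (l - t) + 1].
Proof.
have n0 : 0 < n.+1%:R^-1 :> R by rewrite invr_gt0 ltr0n.
have near1 S (a : X) p p' : is_simplex S -> in_simplex S a -> 0 < a p -> S p' ->
    vnear 1 p' p.
  by move=> hS Sa ap Sp'; apply: simplex_vnear (Sp') _ => //; exact/Sa/lt0r_neq0.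
(* The additive 1 in the bound pays for the step from [q] to the first peak. *)
elim=> [{}x xq|S {}x y {}z {}l hS Sx Sy _ IH zq].
  have [p xp] := building_peak x; have [S hS Sx] := bary_simplex x.
  exists p, 1%N, 0; rewrite !subrr !mulr0 subr0 add0r ltr01; split=> //.
  by apply: (simplex_vnear _ hS); apply: Sx => //; exact/lt0r_neq0/(lt_le_trans n0).
have [p [N [t [pq yp t0 t1 Nt]]]] := IH zq.
set a := apt_norm _; have a0 : 0 <= a by exact: apt_norm_ge0.
have xp : n.+1%:R^-1 - 2 * (t + a) <= x p.
  have := bary_lipschitz p hS Sx Sy; rewrite -/a => /ler_normlP[h _].
  move: (n.+1%:R^-1) (x p) (y p) yp h => d u v; lra.
have [ta|ta] := ltP (4 * n.+1%:R * (t + a)) 1.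
  by exists p, N, (t + a); split => //; [lra|apply: le_trans Nt _; lra].
(* Both [x] and [y] lie in [S], which therefore contains the old vertex and the new peak. *)
have [p' xp'] := building_peak x.
exists p', (1 + N)%N, 0; rewrite !mulr0 !subr0 ltr01; split=> //.
- apply: vnear_trans pq; apply: (near1 S y) => //.
    apply: lt_le_trans yp; rewrite subr_gt0.
    by rewrite -(ltr_pM2l (ltr0Sn R n)) divff//; lra.
  by apply: Sx; apply: lt0r_neq0; exact: lt_le_trans xp'.
- by rewrite natrD; lra.
Qed.

(** The constant 2 pays for one step at each end, between the given vertex and the tracked one. *)
Lemma chain_vnear_carrier x z l p q N : chain x z l -> x p != 0 -> z q != 0 ->
  4 * n.+1%:R * l + 2 <= N%:R -> vnear N p q.
Proof.
move=> /chain_vnear H xp /H {H} [p' [M [t [pq xp' t0 t1 Mt]]]] lN.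
have [S hS Sx] := bary_simplex x.
apply: (@vnear_le _ _ _ _ _ (1 + M)); last first.
  apply: vnear_trans pq; apply: (simplex_vnear _ hS); apply: Sx => //.
  apply: lt0r_neq0; apply: lt_le_trans xp'; rewrite subr_gt0.
  by rewrite -(ltr_pM2l (ltr0Sn R n)) divff//; lra.
rewrite -(ler_nat R) natrD (le_trans _ lN)//.
have : 0 <= 4 * n.+1%:R * t by rewrite !mulr_ge0.
by move: Mt; rewrite mulrBr; lra.
Qed.

Lemma mdist_vnear x y p q r N : x p != 0 -> y q != 0 -> mdist x y < r ->
  4 * n.+1%:R * r + 2 <= N%:R -> vnear N p q.
Proof.
move=> xp yq xyr rN.
have hi : has_inf [set l | chain x y l].
  by split; [exact: building_connected|exists 0 => l /chain_ge0].
have e0 : 0 < r - mdist x y by rewrite subr_gt0.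
have [l xyl] := inf_adherent e0 hi.
rewrite [inf _](_ : _ = mdist x y)// addrC subrK => lr.
apply: (chain_vnear_carrier xyl xp yq); apply: le_trans rN.
by rewrite lerD2r ler_pM2l ?mulr_gt0// ltW.
Qed.

Definition diam : R := Num.sqrt (4 * n.+1%:R).

(** Folding coordinates lie in [[0, 1]], so each of the [n.+1] deviations of their difference from
    its mean is at most 2 in absolute value. *)
Lemma simplex_diam (S : set vert) x y : is_simplex S ->
  in_simplex S x -> in_simplex S y -> mdist x y <= diam.
Proof.
move=> hS Sx Sy; apply: (le_trans (building_dist_le (chain_step hS Sx Sy))).
have F01 z i : 0 <= folding z 0 i <= 1.
  have [S' hS' Sz] := bary_simplex z.
  have z0 p : ~ S' p -> z p = 0 by move=> nS; exact: in_simplex0 Sz nS.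
  rewrite mxE (sum_simplex hS'); last by move=> p /z0 ->; rewrite mul0r.
  rewrite sumr_ge0 => [|p _]; last by rewrite mulr_ge0 ?bary_ge0.
  rewrite -[leRHS](bary_sum z) (sum_simplex hS' z0) ler_sum// => p _.
  apply: ler_piMr; first exact: bary_ge0.
  by rewrite (ler_nat R _ 1) leq_b1.
set a := folding x - folding y.
have a1 i : `|a 0 i| <= 1.
  by rewrite !mxE ler_norml; have := F01 x i; have := F01 y i; rewrite !mxE; lra.
have m1 : `|(\sum_j a 0 j) / n.+1%:R| <= 1.
  rewrite normrM [X in _ * X]ger0_norm ?invr_ge0// ler_pdivrMr// mul1r.
  apply: le_trans (ler_norm_sum _ _ _) _.
  by apply: le_trans (ler_sum _ (fun i _ => a1 i)) _; rewrite sumr_const card_ord.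
rewrite ler_wsqrtr// mulr_natr -[n.+1 in leRHS]card_ord -sumr_const.
apply: ler_sum => i _; have := a1 i; move: m1.
move: (_ / _) (a 0 i) => m b /ler_normlP[m1 m2] /ler_normlP[b1 b2].
have h : 0 <= (2 - (b - m)) * (2 + (b - m)) by apply: mulr_ge0; lra.
by rewrite expr2; lra.
Qed.

Lemma mdist_vpoint x p : x p != 0 -> mdist x (vpoint R p) <= diam.
Proof.
move=> xp; have [S hS Sx] := bary_simplex x.
by apply: (simplex_diam hS) => //; exact: in_simplex_vpoint (Sx _ xp).
Qed.

Local Notation L := (@trilat K nu pi n.+1).
Implicit Types a b : 'I_n.+1 -> int.

(** The bounds on [b] place the lattice of [b] between that of [a] and its multiple by [pi], so the
    classes coincide or span an edge. *)
Lemma trilat_simplex a b m p q : unitri m -> (forall i, a i <= b i <= a i + 1) ->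
  vclass p (L a m) -> vclass q (L b m) ->
  exists S : set vert, [/\ is_simplex S, S p & S q].
Proof.
move=> mU ab pa qb.
have [->|pq] := eqVneq p q; first by exists [set q]; split => //; exact: is_simplex1.
have [pi0 _] := uniformizerP pi1.
pose V (i : 'I_2) := if i == ord0 then q else p.
pose A (i : 'I_2) := if i == ord0 then L b m else L a m.
exists (range V); split; [|by exists ord_max|by exists ord0].
exists 1%N, V, A, pi; split => //.
- split => // i j; rewrite /V.
  case: eqP => [->|/eqP i0]; case: eqP => [->|/eqP j0] // E.
  + by rewrite E eqxx in pq.
  + by rewrite E eqxx in pq.
  + by apply/val_inj; case: i j i0 j0 {E} => -[|[|//]] ? [[|[|//]] ?].
- by move=> j; rewrite /V /A; case: eqP.
- move=> i j ij; rewrite /A; case: eqP => [_|i0]; case: eqP => [j0|_] //.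
    by apply: trilat_le => // k; case/andP: (ab k).
  by exfalso; apply/i0/val_inj/eqP; move: ij; rewrite j0 leqn0.
- rewrite /A /= scale_trilat ?invr_neq0//; apply: trilat_le => // k.
  have -> : fine (nu pi^-1) = -1 by rewrite [LHS]fdvalV// pi1.
  by have := ab k; lia.
Qed.

(** Within one apartment, capping [b] at [a + N] gives a vertex in a common simplex with [q];
    induction covers the remaining distance. *)
Lemma mdist_trilat N a b m p q : unitri m ->
  (forall i, a i <= b i <= a i + N%:Z) ->
  vclass p (L a m) -> vclass q (L b m) ->
  mdist (vpoint R p) (vpoint R q) <= N%:R * diam.
Proof.
move=> mU; elim: N b q => [|N IH] b q ab pa qb.
  have E : a = b by apply/funext => i; have := ab i; lia.
  rewrite -E in qb; rewrite (vclass_inj pa qb) mul0r.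
  by rewrite [mdist _ _]building_distxx.
pose b' i := Num.min (b i) (a i + N%:Z).
pose r : vert := mkv nu (pidiag_unitmx pi1 b' mU).
have rb' : vclass r (L b' m).
  by exists 1; rewrite /= ?oner_neq0// scale_set_val_lattice scale1r.
have rq : mdist (vpoint R r) (vpoint R q) <= diam.
  have [i|S [hS Sr Sq]] := trilat_simplex mU _ rb' qb.
    by have := ab i; rewrite /b'; lia.
  by apply: (simplex_diam hS); exact: in_simplex_vpoint.
apply: le_trans (building_dist_triangle (vpoint R r) _ _) _.
rewrite -natr1 mulrDl mul1r; apply: lerD rq.
by apply: (IH b') => // i; have := ab i; rewrite /b'; lia.
Qed.

(** Coarsening keeps the matrix [vmx p] and moves each exponent by at most [M], uniformly in [p]. *)
Lemma mdist_coarse N : exists D : R, forall x p, x p != 0 ->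
  mdist x (vpoint R (coarse pi1 N p)) <= D.
Proof.
set M := (N.*2.+1 + n.+1 * (N.*2.+1 + N))%N.
exists (diam + M%:R * diam) => x p xp.
apply: le_trans (building_dist_triangle (vpoint R p) _ _) _.
apply: lerD; first exact: mdist_vpoint.
rewrite [building_dist _ _]building_dist_sym.
apply: (mdist_trilat (vmx_unitri pi1 p) (coarse_exp_bound pi1 N p)).
  exact: vclass_coarse.
exact: vclass_vexp.
Qed.

End Realization.

(** * Covers by the fibres of a map, and finiteness of the asymptotic dimension *)

Lemma asdim_le_map (R : realType) (X : metricType R) (d : nat) :
  (forall r : R, 0 < r -> exists (T : Type) (h : X -> T),
    (exists D : R, forall x y, h x = h y -> mdist x y <= D) /\
    (forall x, ([set h y | y in ball x r] #<= `I_d.+1)%card)) ->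
  asdim_le X d.
Proof.
move=> H r /H [T [h [[D hD] hc]]].
exists [set A | exists c, A = h @^-1` [set c]]; split.
- by apply/seteqP; split => // x _; exists (h @^-1` [set h x]) => //; exists (h x).
- by exists D => _ [c ->] x y /= <- /esym; exact: hD.
- move=> x; apply: card_le_trans (hc x).
  apply: card_le_trans (card_image_le (fun c => h @^-1` [set c]) _).
  apply: subset_card_le => _ [[c ->] [y [/= yc xy]]].
  by exists c => //; exists y.
Qed.

Theorem theorem3p12 (R : realType) (K : fieldType) (nu : discrete_valuation K)
    (n : nat) (hn : (0 < n)%N) :
  finite_asdim (building R nu n).
Proof.
case: n hn => // n _.
have [pi pi1] := cid (dval_uniformizer nu).
(* The [2^n.+1] keys bound the multiplicity; [asdim_le] allows one member more, which [card_le_II]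
   absorbs. *)
exists #|{: {ffun 'I_n.+1 -> bool}}|; apply: asdim_le_map => r r0.
have [N rN] : exists N : nat, 4 * n.+1%:R * r + 2 <= N%:R.
  exists (Num.bound (4 * n.+1%:R * r + 2)).
  by rewrite ltW// archi_boundP// addr_ge0// !mulr_ge0// ltW.
have /choice[c xc] : forall x : building R nu n.+1, exists p, x p != 0.
  move=> x; have [p xp] := building_peak x; exists p; apply: lt0r_neq0.
  by apply: lt_le_trans xp; rewrite invr_gt0.
(* Rounding each point to a vertex of its carrier sends an [r]-ball into a [vnear N] ball, on which
   the coarsening takes few values. *)
exists (vertex nu n.+1), (fun x => coarse pi1 (N + N) (c x)); split.
  have [D hD] := mdist_coarse R n pi1 (N + N); exists (D + D) => x y E.
  apply: le_trans (building_dist_triangle _ _ _) (lerD (hD x _ (xc x)) _).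
  by rewrite E [building_dist _ _]building_dist_sym hD.
move=> x; apply: (@card_le_trans _ _ _ (`I_(#|{: {ffun 'I_n.+1 -> bool}}|))).
  apply: card_le_trans (coarse_vnear_card pi1 N (c x)).
  apply: subset_card_le => _ [y xy <-]; exists (c y) => //=.
  apply: (mdist_vnear pi1 (xc x) (xc y) _ rN).
  by move: xy; rewrite ballEmdist.
by rewrite card_le_II.
Qed.
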